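(* Any finite anti-rectangular Abel Grassmann band is isomorphic to $G_n$ for some $n\in\mathbb{N}\cup\{0\}$. If $H$ is an anti-rectangular Abel Grassmann band and $|H|=4^n$, then $H\cong G_n$.
   Context: A groupoid is a nonempty set with a binary operation, written as juxtaposition. An anti-rectangular Abel Grassmann band (the class of these is denoted $\mathbf{ARAGB}$) is a groupoid satisfying $(xy)z=(zy)x$, $x = xx$ and $(xy)x=y$ for all elements $x,y,z$. $\mathbb{N}=\{1,2,3,\dots\}$. $G$ is the four-element groupoid $\{a,b,ab,ba\}$ with Cayley table (entry = row element times column element; columns in the order $a,b,ab,ba$): row $a$: $a,\ ab,\ ba,\ b$; row $b$: $ba,\ b,\ a,\ ab$; row $ab$: $b,\ ba,\ ab,\ a$; row $ba$: $ab,\ a,\ b,\ ba$. It lies in $\mathbf{ARAGB}$. Formal extension $H^x$: let $H\in\mathbf{ARAGB}$ contain $G$ as a subgroupoid and let $x\notin H$. Let $A=\{xh\}_{h\in H}$, $B=\{hx\}_{h\in H}$, $C=\{(ax)h\}_{h\in H}$ be sets of formal symbols, each indexed injectively by $h\in H$, pairwise disjoint and disjoint from $H$. Put $H^x=H\cup A\cup B\cup C$, with $H$ keeping its own product and, for $h,k\in H$ (all products of elements of $H$ on the right-hand sides computed in $H$): - $h\cdot(xk)=(ax)[(ka)h]$, $\ h\cdot(kx)=x(kh)$, $\ h\cdot((ax)k)=[(hk)(ah)]x$; - $(xh)\cdot k=(kh)x$, $\ (xh)\cdot(xk)=x(hk)$, $\ (xh)\cdot(kx)=(ax)[k(ah)]$,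 $\ (xh)\cdot((ax)k)=a(hk)$; - $(hx)\cdot k=(ax)[(ha)(kh)]$, $\ (hx)\cdot(xk)=kh$, $\ (hx)\cdot(kx)=(hk)x$, $\ (hx)\cdot((ax)k)=x[(ah)k]$; - $((ax)h)\cdot k=x[h(ka)]$, $\ ((ax)h)\cdot(xk)=[(hk)a]x$, $\ ((ax)h)\cdot(kx)=(ah)(ka)$, $\ ((ax)h)\cdot((ax)k)=(ax)(hk)$. $G_0$ is the trivial (one-element) groupoid, $G_1=G$, and inductively $G_n=G_{n-1}^{x_{n-1}}$ for $n\ge 2$, where $x_{n-1}\notin G_{n-1}$. *)

(* Defs.v *)
(* A groupoid in the sense of universal algebra is a
   [magmaType]; the juxtaposition xy is [x * y] in [group_scope]. *)
From HB Require Import structures.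
From mathcomp Require Import all_boot.

Set Implicit Arguments.
Unset Strict Implicit.
Unset Printing Implicit Defensive.

Local Open Scope group_scope.

#[short(type="finMagmaType")]
HB.structure Definition FinMagma := {T of Finite T & Magma T}.

(* [magmaType] allows an empty carrier, hence the first field. *)
Record ARAGB (H : magmaType) : Prop := {
  ARAGB_nonempty : inhabited H;
  ARAGB_AG : forall x y z : H, (x * y) * z = (z * y) * x;
  ARAGB_band : forall x : H, x = x * x;
  ARAGB_antirect : forall x y : H, (x * y) * x = y }.

Definition magma_isom (S T : magmaType) : Prop :=
  exists f : {multiplicative S -> T}, bijective f.

Variant G : Type := Ga | Gb | Gab | Gba.

Definition G_mul (x y : G) : G :=
  match x, y with
  | Ga, Ga => Ga   | Ga, Gb => Gab  | Ga, Gab => Gba  | Ga, Gba => Gb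
  | Gb, Ga => Gba  | Gb, Gb => Gb   | Gb, Gab => Ga   | Gb, Gba => Gab
  | Gab, Ga => Gb  | Gab, Gb => Gba | Gab, Gab => Gab | Gab, Gba => Ga
  | Gba, Ga => Gab | Gba, Gb => Ga  | Gba, Gab => Gb  | Gba, Gba => Gba
  end.

HB.instance Definition _ := hasMul.Build G G_mul.

Lemma G_ARAGB : ARAGB G.
Proof. by split; [exact: (inhabits Ga) | case; case; case | case | case; case]. Qed.

HB.instance Definition _ := hasMul.Build unit (fun _ _ => tt).

(* The formal extension H^x.  The inclusion of G in H is an explicit
   morphism [i], so the element a of H is [i Ga].  The four constructors stand
   for h itself and for the formal symbols xh, hx and (ax)h.  The products are
   defined for every H, although they are only meant for H in ARAGB. *)
Variant ext (H : magmaType) (i : {multiplicative G -> H}) : Type :=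
  | ext_h of H
  | ext_xh of H
  | ext_hx of H
  | ext_axh of H.

Arguments ext_h {H} i.
Arguments ext_xh {H} i.
Arguments ext_hx {H} i.
Arguments ext_axh {H} i.

Definition ext_mul (H : magmaType) (i : {multiplicative G -> H})
    (u v : ext i) : ext i :=
  let a := i Ga in
  match u, v with
  | ext_h h,   ext_h k   => ext_h i (h * k)
  | ext_h h,   ext_xh k  => ext_axh i ((k * a) * h)
  | ext_h h,   ext_hx k  => ext_xh i (k * h)
  | ext_h h,   ext_axh k => ext_hx i ((h * k) * (a * h))
  | ext_xh h,  ext_h k   => ext_hx i (k * h)
  | ext_xh h,  ext_xh k  => ext_xh i (h * k)
  | ext_xh h,  ext_hx k  => ext_axh i (k * (a * h))
  | ext_xh h,  ext_axh k => ext_h i (a * (h * k))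
  | ext_hx h,  ext_h k   => ext_axh i ((h * a) * (k * h))
  | ext_hx h,  ext_xh k  => ext_h i (k * h)
  | ext_hx h,  ext_hx k  => ext_hx i (h * k)
  | ext_hx h,  ext_axh k => ext_xh i ((a * h) * k)
  | ext_axh h, ext_h k   => ext_xh i (h * (k * a))
  | ext_axh h, ext_xh k  => ext_hx i ((h * k) * a)
  | ext_axh h, ext_hx k  => ext_h i ((a * h) * (k * a))
  | ext_axh h, ext_axh k => ext_axh i (h * k)
  end.

HB.instance Definition _ (H : magmaType) (i : {multiplicative G -> H}) :=
  hasMul.Build (ext i) (@ext_mul H i).

Fact ext_h_multiplicative (H : magmaType) (i : {multiplicative G -> H}) :
  {morph ext_h i : x y / x * y}.
Proof. by []. Qed.

HB.instance Definition _ (H : magmaType) (i : {multiplicative G -> H}) :=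
  isMultiplicative.Build H (ext i) (ext_h i) (@ext_h_multiplicative H i).

(* A groupoid with a copy of G as a subgroupoid: iterating the extension
   requires keeping track of how G sits inside the groupoid. *)
Record over_G : Type := OverG {
  over_G_magma : magmaType;
  over_G_incl : {multiplicative G -> over_G_magma};
  over_G_inj : injective over_G_incl }.

Definition over_G_self : over_G :=
  @OverG G (idfun : {multiplicative G -> G}) (fun _ _ e => e).

Fact ext_incl_inj (E : over_G) :
  injective (ext_h (over_G_incl E) \o over_G_incl E).
Proof. by move=> x y [/over_G_inj]. Qed.

Definition over_G_ext (E : over_G) : over_G :=
  @OverG (ext (over_G_incl E))
    (ext_h (over_G_incl E) \o over_G_incl E
       : {multiplicative G -> ext (over_G_incl E)})
    (@ext_incl_inj E).

Definition Gn (n : nat) : magmaType :=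
  if n is m.+1 then over_G_magma (iter m over_G_ext over_G_self) else unit.

(* Main.v *)
Require Import Defs.
From HB Require Import structures.
From mathcomp Require Import all_boot.

(** A groupoid in ARAGB is an affine space over the field with four elements:
    if w is a root of w^2 + w + 1, its product is x y = w x + w^2 y.  This
    explains why only the dimension matters and why sizes are powers of 4;
    G is the affine line, and passing from S to its formal extension by x adds
    one dimension, the four sorts of elements being the four translates of S in
    the direction of x.  The proof expresses this picture by equations.

    Let H be a finite member of ARAGB.  A copy of the one-point groupoid always
    embeds in H, and if an embedding of G_n in H misses a point x, it extends
    to an embedding of G_(n+1).  For n = 0 the missed point and the given one
    generate a copy of G ([G_embeds]).  For n > 0 each formal symbol of the
    extension is read as the actual product in H; the multiplication table of
    the extension then holds because it consists of identities of ARAGB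
    ([ext_lift_multiplicative]), and different symbols have different values
    because x is missed ([ext_lift_inj]).  As G_n has 4^n elements
    ([Gn_card]), these embeddings cannot exist for all n, so one of them is
    onto.  This gives an isomorphism of H with some G_m; then |H| = 4^m, which
    determines m and yields the second assertion. *)

Set Implicit Arguments.
Unset Strict Implicit.
Unset Printing Implicit Defensive.

(** * Identities of anti-rectangular Abel Grassmann bands *)

Section Laws.

Local Open Scope group_scope.

Variables (H : magmaType) (HH : ARAGB H).
Implicit Types x y z h k a b : H.

Lemma mulAG x y z : (x * y) * z = (z * y) * x.
Proof. exact: ARAGB_AG HH x y z. Qed.

Lemma mulidem x : x * x = x.
Proof. exact/esym/(ARAGB_band HH). Qed.

Lemma mulKl x y : (x * y) * x = y.
Proof. exact: ARAGB_antirect HH x y. Qed.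

Lemma mulKr x y : x * (y * x) = y.
Proof. by rewrite -{1}(mulKl y x) mulKl. Qed.

(** The product is affine in both arguments together.  With [mulAG] and
    [mulAGr], this carries the identities behind the table below. *)
Lemma mul_medial x y z t : (x * y) * (z * t) = (x * z) * (y * t).
Proof. by rewrite mulAG (mulAG z) mulAG. Qed.

Lemma mulAGr x y z : x * (y * z) = z * (y * x).
Proof. by rewrite -{1}(mulKr x y) (mulAG x) mulKr. Qed.

Lemma mullid x y : x * (x * y) = y * x.
Proof. by rewrite mulAGr mulidem. Qed.

Lemma mulrid x y : (x * y) * y = y * x.
Proof. by rewrite mulAG mulidem. Qed.

Lemma mulDl x y z : x * (y * z) = (x * y) * (x * z).
Proof. by rewrite -mul_medial mulidem. Qed.

Lemma mulDr x y z : (y * z) * x = (y * x) * (z * x).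
Proof. by rewrite -mul_medial mulidem. Qed.

Lemma mulIl x : injective (fun y => x * y).
Proof. by move=> y z /= e; rewrite -(mulKl x y) e mulKl. Qed.

Lemma mulIr x : injective (fun y => y * x).
Proof. by move=> y z /= e; rewrite -(mulKr x y) e mulKr. Qed.

(** The entries of the multiplication table of the formal extension, read in H;
    those left out are instances of the laws above.  Each is a linear identity
    over the four-element field. *)
Section Table.
Variables a x h k : H.

Lemma mul_h_xk : h * (x * k) = (a * x) * ((k * a) * h).
Proof. by rewrite mul_medial mulKr (mulAGr k). Qed.

Lemma mul_h_axk : h * ((a * x) * k) = ((h * k) * (a * h)) * x.
Proof. by rewrite [RHS]mulAG (mulAGr x) -mulDl. Qed.

Lemma mul_xh_kx : (x * h) * (k * x) = (a * x) * (k * (a * h)).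
Proof.
(* Writing h as z a with z = a h turns both sides into (x (x a)) (k z). *)
by rewrite -{1}(mulKl a h) mul_medial (mulAG _ a x) mul_medial mullid.
Qed.

Lemma mul_xh_axk : (x * h) * ((a * x) * k) = a * (h * k).
Proof. by rewrite mul_medial mulKr. Qed.

Lemma mul_hx_k : (h * x) * k = (a * x) * ((h * a) * (k * h)).
Proof. by rewrite mul_medial mulKr (mulAGr x) mullid (mulAG k). Qed.

Lemma mul_hx_xk : (h * x) * (x * k) = k * h.
Proof. by rewrite mulAG mulKl. Qed.

Lemma mul_hx_axk : (h * x) * ((a * x) * k) = x * ((a * h) * k).
Proof. by rewrite mul_medial (mulAGr h) -mulDl. Qed.

Lemma mul_axh_k : ((a * x) * h) * k = x * (h * (k * a)).
Proof. by rewrite mulAG mul_medial mulAGr. Qed.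

Lemma mul_axh_xk : ((a * x) * h) * (x * k) = ((h * k) * a) * x.
Proof. by rewrite mul_medial mulrid mulAG. Qed.

Lemma mul_axh_kx : ((a * x) * h) * (k * x) = (a * h) * (k * a).
Proof.
(* With u = h x, so that h = x u, both sides become (u k) (a x). *)
rewrite -{2}(mulKr x h) (mulAGr a x) (mulAG a).
by rewrite [LHS]mul_medial [RHS]mul_medial mulrid.
Qed.

End Table.

End Laws.

(** * Extending embeddings of G and of formal extensions *)

Section Extend.

Local Open Scope group_scope.

Variables (H : magmaType) (HH : ARAGB H).

Section Generators.
Variables a b : H.

Definition G_lift (s : G) : H :=
  match s with Ga => a | Gb => b | Gab => a * b | Gba => b * a end.

Fact G_lift_multiplicative : {morph G_lift : s t / s * t}.
Proof.
have ab_ba (c d : H) : (c * d) * (d * c) = c.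
  by rewrite (mulAG HH) (mulKl HH) (mulidem HH).
by case; case=> /=; rewrite ?(mulidem HH, mulKl HH, mulKr HH, mullid HH,
  mulrid HH, ab_ba).
Qed.

HB.instance Definition _ :=
  isMultiplicative.Build G H G_lift G_lift_multiplicative.

(** Any two distinct elements s and t of G generate it, as all four elements occur
    among s, t, s t and t s.  So if s and t had the same value, idempotency would
    make the map constant. *)
Lemma G_lift_inj : a <> b -> injective G_lift.
Proof.
move=> neq_ab s t e; have [f_st f_ts] : G_lift (s * t) = G_lift t /\
    G_lift (t * s) = G_lift t by rewrite !G_lift_multiplicative e (mulidem HH).
by case: s t e f_st f_ts => [] [] //= e1 e2 e3; case: neq_ab; congruence.
Qed.

Lemma G_embeds : a <> b -> exists f : {multiplicative G -> H}, injective f.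
Proof. by exists G_lift; exact: G_lift_inj. Qed.

End Generators.

Section Adjoin.
Variables (S : magmaType) (i : {multiplicative G -> S}).
Variables (f : {multiplicative S -> H}) (x : H).

Definition ext_lift (u : ext i) : H :=
  match u with
  | ext_h h => f h
  | ext_xh h => x * f h
  | ext_hx h => f h * x
  | ext_axh h => (f (i Ga) * x) * f h
  end.

Fact ext_lift_multiplicative : {morph ext_lift : u v / u * v}.
Proof.
case=> h [] k; rewrite [LHS]/=.
- exact: gmulfM.
- by rewrite !gmulfM -mul_h_xk.
- by rewrite gmulfM -(mulAGr HH).
- by rewrite !gmulfM -mul_h_axk.
- by rewrite gmulfM -(mulAG HH).
- by rewrite gmulfM (mulDl HH).
- by rewrite !gmulfM -mul_xh_kx.
- by rewrite !gmulfM -(mul_xh_axk HH _ x).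
- by rewrite !gmulfM -mul_hx_k.
- by rewrite gmulfM -(mul_hx_xk HH x).
- by rewrite gmulfM (mulDr HH).
- by rewrite !gmulfM -mul_hx_axk.
- by rewrite !gmulfM -mul_axh_k.
- by rewrite !gmulfM -mul_axh_xk.
- by rewrite !gmulfM -(mul_axh_kx HH _ x).
- by rewrite gmulfM (mulDl HH).
Qed.

HB.instance Definition _ :=
  isMultiplicative.Build (ext i) H ext_lift ext_lift_multiplicative.

Hypothesis f_inj : injective f.
Hypothesis x_notin : forall s, f s <> x.

(** If x h, h x or (a x) h, with a and h in S, had a value in S, then so would x,
    since a product and one of its factors determine the other factor by a
    multiplication. *)
Lemma ext_lift_eq_h u h :
  ext_lift u = ext_lift (ext_h i h) -> exists k, u = ext_h i k.
Proof.
case: u => k /= e; first by exists k.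
- by case: (@x_notin (k * h)); rewrite gmulfM -e (mulKr HH).
- by case: (@x_notin (h * k)); rewrite gmulfM -e (mulKl HH).
- case: (@x_notin (k * h * i Ga)).
  by rewrite !gmulfM -e (mulKr HH) (mulKl HH).
Qed.

(** If two elements have the same value, it is also the value of their product by
    idempotency; but in the table the product of elements of two different sorts
    is of a third sort.  For two sorts of formal symbols this leads from (x h, h x)
    and (h x, (a x) h) to (x h, (a x) h), and from there to S, where
    [ext_lift_eq_h] applies. *)
Lemma ext_lift_inj : injective ext_lift.
Proof.
have idemE u v : ext_lift u = ext_lift v -> ext_lift (u * v) = ext_lift u.
  by move=> e; rewrite ext_lift_multiplicative -e (mulidem HH).
have sep_xh_axh h k : ext_lift (ext_xh i h) <> ext_lift (ext_axh i k).
  by move=> /idemE/esym/ext_lift_eq_h[].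
have sep_xh_hx h k : ext_lift (ext_xh i h) <> ext_lift (ext_hx i k).
  by move=> /idemE/esym/sep_xh_axh.
have sep_hx_axh h k : ext_lift (ext_hx i h) <> ext_lift (ext_axh i k).
  by move=> /idemE/sep_xh_hx.
case=> h [] k e.
- by congr ext_h; exact: f_inj.
- by have [] := ext_lift_eq_h (esym e).
- by have [] := ext_lift_eq_h (esym e).
- by have [] := ext_lift_eq_h (esym e).
- by have [] := ext_lift_eq_h e.
- by congr ext_xh; apply: f_inj; exact: (mulIl HH) e.
- by case: (sep_xh_hx _ _ e).
- by case: (sep_xh_axh _ _ e).
- by have [] := ext_lift_eq_h e.
- by case: (sep_xh_hx _ _ (esym e)).
- by congr ext_hx; apply: f_inj; exact: (mulIr HH) e.
- by case: (sep_hx_axh _ _ e).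
- by have [] := ext_lift_eq_h e.
- by case: (sep_xh_axh _ _ (esym e)).
- by case: (sep_hx_axh _ _ (esym e)).
- by congr ext_axh; apply: f_inj; exact: (mulIl HH) e.
Qed.

Lemma ext_embeds : exists g : {multiplicative ext i -> H}, injective g.
Proof. by exists ext_lift; exact: ext_lift_inj. Qed.

End Adjoin.

End Extend.

(** * The size of G_n *)

Lemma ext_card (S : magmaType) (i : {multiplicative G -> S}) (T : finType)
    (e : T -> S) : bijective e ->
  exists e' : 'I_4 * T -> ext i, bijective e'.
Proof.
case=> e1 eK e1K.
pose c := [tuple @ext_h S i; @ext_xh S i; @ext_hx S i; @ext_axh S i].
exists (fun p => tnth c p.1 (e p.2)).
pose o k (lt_k4 : k < 4) (s : S) := (Ordinal lt_k4, e1 s).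
exists (fun u => match u with
  | ext_h s => o 0 isT s | ext_xh s => o 1 isT s
  | ext_hx s => o 2 isT s | ext_axh s => o 3 isT s end).
  move=> [[[|[|[|[|k]]]] lt_k4] t] //=; rewrite /o eK; congr pair; exact: val_inj.
by case=> s /=; rewrite (tnth_nth (@ext_h S i)) /= e1K.
Qed.

(** The size of G_n is expressed by a finite type in bijection with it, since the
    iterated extension only produces a bare groupoid. *)
Lemma Gn_card n : exists (T : finType) (e : T -> Gn n),
  bijective e /\ #|T| = 4 ^ n.
Proof.
elim: n => [|[|n] IHn].
- by exists unit, id; split; [exists id | rewrite card_unit].
- exists 'I_4, (tnth [tuple Ga; Gb; Gab; Gba]); split; last by rewrite card_ord.
  exists (fun s => match s with
    | Ga => inord 0 | Gb => inord 1 | Gab => inord 2 | Gba => inord 3 end).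
    by move=> [[|[|[|[|k]]]] lt_k4] //; apply: val_inj; rewrite /= inordK.
  by case; rewrite (tnth_nth Ga) inordK.
- have [T [e [e_bij cardT]]] := IHn.
  have [e' e'_bij] := ext_card (over_G_incl (iter n over_G_ext over_G_self)) e_bij.
  exists ('I_4 * T)%type, e'; split=> //.
  by rewrite card_prod card_ord cardT -expnS.
Qed.

Lemma Gn_finite_card (T : finType) n (f : T -> Gn n) :
  bijective f -> #|T| = 4 ^ n.
Proof.
have [U [e [[e1 eK e1K] <-]]] := Gn_card n => f_bij.
apply: (@bij_eq_card _ _ (e1 \o f)); apply: bij_comp f_bij.
by exists e.
Qed.

(** * Filling a finite band with copies of G_n *)

Lemma magma_isom_sym (S T : magmaType) : magma_isom S T -> magma_isom T S.
Proof.
case=> f [g fK gK].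
pose gM := isMultiplicative.Build T S g (can2_gmulfM fK gK).
pose g' : {multiplicative T -> S} := HB.pack g gM.
by exists g'; exists f.
Qed.

(** As G_n is finite, whether an injection is onto can be decided by listing its
    values. *)
Lemma embed_Gn (H : finMagmaType) n (f : Gn n -> H) : injective f ->
  4 ^ n <= #|H| /\ (bijective f \/ exists x, forall s, f s <> x).
Proof.
have [T [e [[e1 eK e1K] <-]]] := Gn_card n => f_inj.
have fe_inj : injective (f \o e) by apply: inj_comp => //; exact: can_inj eK.
split; first exact: leq_card fe_inj.
case: (pickP [pred x | x \notin codom (f \o e)]) => [x /= x_notin | all_in].
  right; exists x => s fs; case/codomP: x_notin; exists (e1 s).
  by rewrite /= e1K.
left; exists (fun x => e (iinv (negbFE (all_in x)))) => [s | x].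
  by apply: f_inj; rewrite [LHS](f_iinv (negbFE (all_in (f s)))).
by rewrite [LHS](f_iinv (negbFE (all_in x))).
Qed.

Lemma unit_embeds (H : magmaType) : ARAGB H ->
  exists f : {multiplicative unit -> H}, injective f.
Proof.
move=> HH; have [x] := ARAGB_nonempty HH.
have cM : {morph (fun _ : unit => x) : s t / (s * t)%g}.
  by move=> _ _; rewrite (mulidem HH).
pose f : {multiplicative unit -> H} :=
  HB.pack (fun _ : unit => x) (isMultiplicative.Build unit H _ cM).
by exists f; case; case.
Qed.

Lemma Gn_embeds_succ (H : finMagmaType) n (f : {multiplicative Gn n -> H}) :
  ARAGB H -> injective f ->
  magma_isom H (Gn n) \/
  exists g : {multiplicative Gn n.+1 -> H}, injective g.
Proof.
move=> HH f_inj; have [_ [f_bij | [x x_notin]]] := embed_Gn f_inj.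
  by left; apply: magma_isom_sym; exists f.
right; case: n f f_inj x_notin => [|n] f f_inj x_notin.
  exact: (G_embeds HH (x_notin tt)).
exact: (ext_embeds HH (over_G_incl (iter n _ _)) f_inj x_notin).
Qed.

Lemma exists_Gn_isom (H : finMagmaType) :
  ARAGB H -> exists n, magma_isom H (Gn n).
Proof.
move=> HH.
have grow n : (exists m, magma_isom H (Gn m)) \/
    exists f : {multiplicative Gn n -> H}, injective f.
  elim: n => [|n [? | [f f_inj]]]; [right; exact: unit_embeds | by left |].
  by have [|] := Gn_embeds_succ HH f_inj; [left; exists n | right].
(* An embedded G_n with n = |H| would have 4 ^ |H| > |H| elements. *)
have [// | [f f_inj]] := grow #|H|.
have [+ _] := embed_Gn f_inj.
by rewrite leqNgt ltn_expl.
Qed.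

Theorem corollary5 :
  (forall H : finMagmaType, ARAGB H -> exists n : nat, magma_isom H (Gn n)) /\
  (forall (H : finMagmaType) (n : nat),
     ARAGB H -> #|H| = 4 ^ n -> magma_isom H (Gn n)).
Proof.
split=> [|H n /exists_Gn_isom[m iso_m] cardH]; first exact: exists_Gn_isom.
suff <- : m = n by [].
have [f f_bij] := iso_m.
by apply: (@expnI 4) => //; rewrite -cardH (Gn_finite_card f_bij).
Qed.
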